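(* Let $n\ge 1$ and let $P_n$ be a convex cyclic polygon with $n+2$ edges, with vertices $V, V_1, V_2,\dots,V_{n+1}$ in this cyclic order, triangulated from the vertex $V$ into the consecutive triangles $T_j = V V_j V_{j+1}$, $j=1,\dots,n$. For each $j$ let $s_j, r_j, t_j$ be the lengths of the tangent segments to the incircle of $T_j$ from the vertices $V$, $V_j$, $V_{j+1}$ respectively, and let $p_j=r_j+s_j+t_j$ be the semiperimeter of $T_j$. Then the area $A(n)$ of $P_n$ satisfies $$A(n)^2=\left(p_1r_1+\sum_{q=2}^n r_qs_q\prod_{m=2}^{q-1}\frac{s_m}{p_m}\right)\left(s_1t_1+\sum_{q=2}^n p_qt_q\prod_{m=2}^{q-1}\frac{p_m}{s_m}\right).$$
   Context: A polygon is cyclic if all its vertices lie on a common circle. For a triangle $XYZ$, the tangent segment length from the vertex $X$ to the incircle is the common distance from $X$ to the two points where the incircle touches the sides through $X$. Thus, when $s_j, r_j, t_j$ denote the tangent segment lengths to the incircle of the triangle $T_j=VV_jV_{j+1}$ from its vertices $V$, $V_j$, $V_{j+1}$ respectively ($j=1,\dots,n$), one has $|VV_j|=s_j+r_j$, $|VV_{j+1}|=s_j+t_j$, $|V_jV_{j+1}|=r_j+t_j$, and, for the edge $VV_{i+1}$ common to $T_i$ and $T_{i+1}$, $|VV_{i+1}|=s_i+t_i=s_{i+1}+r_{i+1}$ for $i=1,\dots,n-1$. Empty products are equal to $1$ and empty sums are equal to $0$. *)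

(* Defs.v *)
From HB Require Import structures.
From mathcomp Require Import all_boot all_order all_algebra.
From mathcomp Require Import all_classical all_reals all_analysis.

Set Implicit Arguments.
Unset Strict Implicit.
Unset Printing Implicit Defensive.

Import Order.TTheory GRing.Theory Num.Theory.
Local Open Scope classical_set_scope.
Local Open Scope ring_scope.

(* [R^o] is [R] as a module over itself; it makes the plane an [lmodType R].  *)
Notation plane R := (R^o * R^o)%type.

(* The library norm of a product type is the maximum norm, hence this
   Euclidean distance.                                                        *)
Definition dist (R : realType) (X Y : plane R) : R :=
  Num.sqrt ((X.1 - Y.1) ^+ 2 + (X.2 - Y.2) ^+ 2).

(* Positive, negative or zero according to whether Z lies to the left of, to
   the right of, or on the line directed from X to Y.                         *)
Definition side (R : realType) (X Y Z : plane R) : R :=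
  (Y.1 - X.1) * (Z.2 - X.2) - (Y.2 - X.2) * (Z.1 - X.1).

Definition line (R : realType) (X Y : plane R) : set (plane R) :=
  [set X + u *: (Y - X) | u in [set: R]].

Definition segment (R : realType) (X Y : plane R) : set (plane R) :=
  [set X + u *: (Y - X) | u in `[0%R, 1%R]%classic].

Definition circle (R : realType) (O : plane R) (rho : R) : set (plane R) :=
  [set Z | dist O Z = rho].

Definition convex_hull (R : realType) (M : lmodType R) (A : set M) : set M :=
  smallest (@convex_set R M) A.

(* A polygon with m edges is the closed chain of its vertices P 0, ..., P (m-1);
   its edges join P i to P (ordS i), where ordS is the cyclic successor.  It is
   convex when each edge has all the remaining vertices strictly on one side of
   its line; in particular the vertices are listed in their cyclic order, in
   either direction of rotation.                                              *)
Definition convex_polygon (R : realType) (m : nat) (P : 'I_m -> plane R) : Prop :=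
  forall i : 'I_m,
    (forall k, k != i -> k != ordS i -> 0 < side (P i) (P (ordS i)) (P k)) \/
    (forall k, k != i -> k != ordS i -> side (P i) (P (ordS i)) (P k) < 0).

Definition cyclic_polygon (R : realType) (m : nat) (P : 'I_m -> plane R) : Prop :=
  exists (O : plane R) (rho : R), 0 < rho /\ forall i, circle O rho (P i).

(* The region bounded by a convex polygon is the convex hull of its vertices;
   its area is its two-dimensional Lebesgue measure.                          *)
Definition convex_polygon_area (R : realType) (m : nat) (P : 'I_m -> plane R) :
    \bar R :=
  ((@lebesgue_measure R) \x (@lebesgue_measure R))%E (convex_hull (range P)).

Definition touches_at (R : realType) (O : plane R) (rho : R) (X Y F : plane R) :
    Prop :=
  segment X Y F /\ circle O rho `&` line X Y = [set F].

(* The circle with center O and radius rho is the incircle of the triangle XYZ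
   and touches YZ, ZX, XY at D, E, F: asking that the contact points lie on the
   sides, not merely on their lines, rules out the excircles.                 *)
Definition incircle (R : realType) (X Y Z : plane R) (O : plane R) (rho : R)
    (D E F : plane R) : Prop :=
  [/\ 0 < rho, touches_at O rho Y Z D, touches_at O rho Z X E &
      touches_at O rho X Y F].

Definition tangent_lengths (R : realType) (X Y Z : plane R) (x y z : R) : Prop :=
  exists (O : plane R) (rho : R) (D E F : plane R),
    [/\ incircle X Y Z O rho D E F,
        dist X E = x /\ dist X F = x,
        dist Y D = y /\ dist Y F = y &
        dist Z D = z /\ dist Z E = z].

(* Main.v *)
Require Import Defs.
From HB Require Import structures.
From mathcomp Require Import all_boot all_order all_algebra.
From mathcomp Require Import all_classical all_reals all_analysis.
From mathcomp Require Import measurable_realfun zify ring lra.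

Set Implicit Arguments.
Unset Strict Implicit.
Unset Printing Implicit Defensive.

Import Order.TTheory GRing.Theory Num.Theory.
Local Open Scope ring_scope.

(* With D_j the area of T_j, Heron's formula reads D_j^2 = p_j r_j s_j t_j.  Opposite
   angles of the cyclic quadrilateral V V_j V_(j+1) V_(j+2) are supplementary, so the
   tangents of their halves are inverse to each other; in terms of tangent lengths,
   p_j r_j p_(j+1) t_(j+1) = s_j t_j r_(j+1) s_(j+1).  Hence the summands a_q and b_q of
   the two factors, which satisfy a_q b_q = D_q^2, are in a ratio independent of q, and
   the equality case of the Cauchy-Schwarz inequality gives
   (sum_q a_q) (sum_q b_q) = (sum_q D_q)^2.
   The planar Lebesgue measure is scaled by the determinant under affine maps (Tonelli,
   one fibre direction at a time), which reduces the area of a triangle to that of half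
   the unit square; the polygon is swept triangle by triangle around V. *)

(** * Lebesgue measure in the plane *)

Section planar_area.
Local Open Scope classical_set_scope.
Context {R : realType}.

Local Notation mR := (measurableTypeR R).
Local Notation lambda := (@lebesgue_measure R).
Local Notation area := (lambda \x lambda)%E.
(* The type R alone would select another measurable structure than that of area. *)
Local Notation measurable2 := (@measurable _ (mR * mR)%type).

Lemma measurable_affine (c d : R) :
  measurable_fun [set: mR] ((fun x => c * x + d) : mR -> mR).
Proof. by apply: measurable_funD => //; exact: measurable_funM. Qed.

(** By uniqueness of Lebesgue measure it suffices to compare both sides on the intervals []a, b]].
    For [c < 0] the preimage is closed on the left and open on the right, hence the two cases. *)
Lemma lebesgue_measure_affine (c d : R) (A : set mR) : c != 0 -> measurable A ->
  (`|c|%:E * lambda ((fun x => (c * x + d)%R) @^-1` A))%E = lambda A.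
Proof.
move=> c0 mA.
pose f x : mR := c * x + d.
have mf : measurable_fun [set: mR] (f : mR -> mR) by exact: measurable_affine.
apply/esym/(@lebesgue_measure_unique R
  (mscale (NngNum (normr_ge0 c)) (pushforward lambda f))) => // _ [[a b]] _ <-.
rewrite /= /mscale /pushforward /= lebesgue_measure_itv/= lte_fin /f.
have [cgt0|clt0|ceq0] := ltgtP c 0; last by rewrite ceq0 eqxx in c0.
  rewrite [X in (_ * X)%E](_ : _ = lambda `[(b - d) / c, (a - d) / c[%classic);
      last first.
    congr (lambda _); apply/seteqP.
    split=> x /=; rewrite !in_itv/= => /andP[h1 h2]; apply/andP;
    move: h1 h2; rewrite ?ler_ndivrMr ?ltr_ndivlMr ?ler_ndivlMr ?ltr_ndivrMr//;
    by split; lra.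
  rewrite lebesgue_measure_itv/= lte_fin ltr_nM2r ?invr_lt0// ltrD2r.
  case: ifPn => ab; last by rewrite mule0.
  by rewrite -!EFinD -EFinM ltr0_norm//; congr EFin; field.
rewrite [X in (_ * X)%E](_ : _ = lambda `](a - d) / c, (b - d) / c]%classic);
    last first.
  congr (lambda _); apply/seteqP.
  split=> x /=; rewrite !in_itv/= => /andP[h1 h2]; apply/andP;
  move: h1 h2; rewrite ?ler_pdivrMr ?ltr_pdivlMr ?ler_pdivlMr ?ltr_pdivrMr//;
  by split; lra.
rewrite lebesgue_measure_itv/= lte_fin ltr_pM2r ?invr_gt0// ltrD2r.
case: ifPn => ab; last by rewrite mule0.
by rewrite -!EFinD -EFinM gtr0_norm//; congr EFin; field.
Qed.

(** The product measure integrates vertical sections; the version integrating horizontal sections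
    agrees with it on rectangles, hence everywhere. *)
Lemma area_ysection (A : set (mR * mR)) : measurable A ->
  area A = (\int[lambda]_y lambda (ysection A y))%E.
Proof.
move=> mA; have := @product_measure_unique _ _ _ _ _ lambda lambda.
move=> /(_ (lambda \x^ lambda)%E) -> //.
by move=> *; exact: product_measure2E.
Qed.

Lemma measurable_affine2 (a b c : R) :
  measurable_fun [set: mR * mR] ((fun z => a * z.1 + b * z.2 + c) : mR * mR -> mR).
Proof.
by apply: measurable_funD => //; apply: measurable_funD; exact: measurable_funM.
Qed.

Lemma measurable_affine_map (a b e c d f : R) :
  measurable_fun [set: mR * mR]
    ((fun z => (a * z.1 + b * z.2 + e, c * z.1 + d * z.2 + f)) : mR * mR -> mR * mR).
Proof. by apply: measurable_fun_pair; exact: measurable_affine2. Qed.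

Lemma measurable_preimage_affine_map (a b e c d f : R) (A : set (mR * mR)) :
  measurable A -> measurable
    ((fun z : mR * mR => (a * z.1 + b * z.2 + e, c * z.1 + d * z.2 + f)) @^-1` A).
Proof.
by move=> mA; rewrite -[X in measurable X]setTI; exact: measurable_affine_map.
Qed.

(** On the vertical line over [x] the map is the one-dimensional affine map with slope [d] and
    offset [a * x + f], so every section is scaled by the same factor. *)
Lemma area_fibre_snd (a d f : R) (A : set (mR * mR)) : d != 0 -> measurable A ->
  (`|d|%:E * area ((fun z => (z.1, (a * z.1 + d * z.2 + f)%R)) @^-1` A))%E = area A.
Proof.
move=> d0 mA; rewrite /product_measure1.
have mB : measurable ((fun z : mR * mR => (z.1, (a * z.1 + d * z.2 + f)%R)) @^-1` A).
  have := measurable_preimage_affine_map 1 0 0 a d f mA.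
  by congr measurable; apply/seteqP; split => -[x y]/=; rewrite mul0r mul1r !addr0.
rewrite -ge0_integralZl//; last exact: measurable_fun_xsection.
apply: eq_integral => x _ /=.
rewrite -(@lebesgue_measure_affine d (a * x + f) (xsection A x)) //;
  last exact: measurable_xsection.
congr (_ * lambda _)%E; apply/seteqP; split => y; rewrite /xsection/= !inE/=.
  by congr (A (_, _)); ring.
by congr (A (_, _)); ring.
Qed.

Lemma area_fibre_fst (a b e : R) (A : set (mR * mR)) : a != 0 -> measurable A ->
  (`|a|%:E * area ((fun z => ((a * z.1 + b * z.2 + e)%R, z.2)) @^-1` A))%E = area A.
Proof.
move=> a0 mA.
have mB : measurable ((fun z : mR * mR => ((a * z.1 + b * z.2 + e)%R, z.2)) @^-1` A).
  have := measurable_preimage_affine_map a b e 0 1 0 mA.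
  by congr measurable; apply/seteqP; split => -[x y]/=; rewrite mul0r mul1r add0r addr0.
rewrite !area_ysection//.
rewrite -ge0_integralZl//; last exact: measurable_fun_ysection.
apply: eq_integral => y _ /=.
rewrite -(@lebesgue_measure_affine a (b * y + e) (ysection A y)) //;
  last exact: measurable_ysection.
congr (_ * lambda _)%E; apply/seteqP; split => x; rewrite /ysection/= !inE/=.
  by congr (A (_, _)); ring.
by congr (A (_, _)); ring.
Qed.

(** For [a != 0] the map factors into one changing only the first coordinate, with factor [a],
    followed by one changing only the second, with factor [k], the determinant divided by [a]. *)
Lemma area_affine_map (a b e c d f : R) (A : set (mR * mR)) :
  a * d - b * c != 0 -> measurable A ->
  (`|a * d - b * c|%:E * area
    ((fun z => (a * z.1 + b * z.2 + e, c * z.1 + d * z.2 + f)%R) @^-1` A))%E = area A.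
Proof.
move=> det0 mA.
(* If [a = 0], precomposing with the shear that sends [(x, y)] to [(x, x + y)] replaces [a] by
   [a + b = b], which is nonzero, and keeps the determinant. *)
wlog a0 : a b c d det0 / a != 0 => [H|].
  have [a0|] := eqVneq a 0; last exact: H.
  have b0 : b != 0.
    by apply: contraNneq det0 => b0; rewrite a0 b0 !mul0r subrr.
  have detE : (a + b) * d - b * (c + d) = a * d - b * c by ring.
  rewrite -(H (a + b) b (c + d) d); rewrite ?detE//; last by rewrite a0 add0r.
  congr (_ * _)%E; rewrite -(@area_fibre_snd 1 1 0)//; last first.
    exact: measurable_preimage_affine_map.
  rewrite normr1 mul1e; congr (area _).
  by apply/seteqP; split => -[x y] /=; congr (A (_, _)); ring.
pose k := (a * d - b * c) / a.
have k0 : k != 0 by rewrite mulf_neq0 ?invr_eq0.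
rewrite -(@area_fibre_snd (c / a) k (f - c * e / a) A)//.
set B := (X in (`|k|%:E * area X)%E).
have mB : measurable B.
  have := measurable_preimage_affine_map 1 0 0 (c / a) k (f - c * e / a) mA.
  by congr measurable; apply/seteqP; split => -[x y]/=; rewrite mul0r mul1r !addr0.
rewrite -(@area_fibre_fst a b e B)//.
rewrite muleA -EFinM -normrM mulfVK//.
congr (_ * area _)%E.
by apply/seteqP; split => -[x y] /=; congr (A (_, _)); rewrite /k/=; field.
Qed.

(** The line is the preimage of the vertical axis under an affine map of determinant
    [a ^+ 2 + b ^+ 2]. *)
Lemma area_line (a b c : R) : (a != 0) || (b != 0) ->
  area [set z : R * R | a * z.1 + b * z.2 + c = 0] = 0%E.
Proof.
move=> ab0.
have det0 : a * a - b * (- b) != 0.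
  by rewrite mulrN opprK paddr_eq0 ?sqr_ge0// !mulf_eq0 !orbb negb_and.
have mA : measurable ([set (0 : mR)] `*` [set: mR]) by exact: measurableX.
have := @area_affine_map a b c (- b) a 0 _ det0 mA.
have -> : area ([set (0 : mR)] `*` [set: mR]) = 0%E.
  by rewrite product_measure1E//= (lebesgue_measure_set1 (0 : R)) mul0e.
move/eqP; rewrite mule_eq0 eqe normr_eq0 (negbTE det0)/= => /eqP <-.
by congr (area _); apply/seteqP; split => -[x y] //= [].
Qed.

Lemma measurable_halfplane (a b c : R) :
  measurable2 [set z : R * R | 0 <= a * z.1 + b * z.2 + c].
Proof.
have := @measurable_affine2 a b c measurableT `[0, +oo[%classic (measurable_itv _).
by rewrite setTI; congr measurable; apply/seteqP; split => z /=; rewrite in_itv/= andbT.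
Qed.

Lemma measurable_line (a b c : R) :
  measurable2 [set z : R * R | a * z.1 + b * z.2 + c = 0].
Proof.
have := @measurable_affine2 a b c measurableT [set 0] (measurable_set1 _).
by rewrite setTI.
Qed.

Let unit_triangle : set (R * R) := [set z | [/\ 0 <= z.1, 0 <= z.2 & z.1 + z.2 <= 1]].

Let measurable_unit_triangle : measurable2 unit_triangle.
Proof.
have -> : unit_triangle = [set z : R * R | 0 <= 1 * z.1 + 0 * z.2 + 0] `&`
    [set z : R * R | 0 <= 0 * z.1 + 1 * z.2 + 0] `&`
    [set z : R * R | 0 <= -1 * z.1 + -1 * z.2 + 1].
  apply/seteqP; split => -[x y]/=.
    by case=> /= h1 h2 h3; split; [split|]; lra.
  by case=> -[h1 h2 h3]; split => /=; lra.
by apply: measurableI; [apply: measurableI|]; exact: measurable_halfplane.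
Qed.

(* The point reflection in the centre of the unit square exchanges its two halves. *)
Let area_unit_triangle : area unit_triangle = (2^-1)%:E.
Proof.
pose refl := (fun z : R * R => (-1 * z.1 + 0 * z.2 + 1, 0 * z.1 + -1 * z.2 + 1)).
have mS : measurable2 (refl @^-1` unit_triangle).
  exact: measurable_preimage_affine_map.
have det0 : (-1) * (-1) - 0 * 0 != 0 :> R by rewrite mulrNN mulr1 mulr0 subr0 oner_neq0.
have := area_affine_map 1 1 det0 measurable_unit_triangle.
rewrite mulrNN mulr1 mulr0 subr0 normr1 mul1e -/refl => areaE.
have null : area (unit_triangle `&` refl @^-1` unit_triangle) = 0%E.
  apply: (@subset_measure0 _ _ _ area _ [set z : R * R | 1 * z.1 + 1 * z.2 + -1 = 0]).
  - exact: measurableI.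
  - exact: measurable_line.
  - by move=> [x y]; rewrite /unit_triangle/refl/= => -[[/= ? ? ?] [/= ? ? ?]]; lra.
  - by apply: area_line; rewrite oner_neq0.
have sq : unit_triangle `|` refl @^-1` unit_triangle =
    `[(0:R), 1]%classic `*` `[(0:R), 1]%classic.
  apply/seteqP; split => -[x y] /=; rewrite /unit_triangle/refl /= !in_itv/=.
    by case=> -[/= h1 h2 h3]; split; apply/andP; split; lra.
  move=> [/andP[x0 x1] /andP[y0 y1]].
  have [xy|xy] := leP (x + y) 1; first by left; split.
  by right; split=> /=; lra.
have sq1 : area (`[(0:R), 1]%classic `*` `[(0:R), 1]%classic) = 1%E.
  by rewrite product_measure1E//= !lebesgue_measure_itv/= lte01 sube0 mule1.
have fin : (area unit_triangle < +oo)%E.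
  apply: (@le_lt_trans _ _ (area (`[(0:R), 1]%classic `*` `[(0:R), 1]%classic))).
    rewrite -sq; apply: le_measure; rewrite ?inE//.
    exact: measurableU.
  by rewrite sq1 ltry.
have := sq1; rewrite -sq.
rewrite (measureUfinl measurable_unit_triangle mS fin)/= null sube0 areaE => two.
have ge0 : (0 <= area unit_triangle)%E by exact: measure_ge0.
move: two fin ge0; case: (area unit_triangle) => // t [] two _ _.
by congr EFin; lra.
Qed.

(** * Triangles in barycentric coordinates *)

Lemma mulr_ge0_div (x y : R) : y != 0 -> (0 <= y * x) = (0 <= x / y).
Proof.
move=> y0; have y2 : 0 < y ^+ 2 by rewrite exprn_even_gt0.
by rewrite -(pmulr_rge0 (x / y) y2); congr (0 <= _); field.
Qed.

(** The three ratios are the barycentric coordinates of [P] at [X], [Y] and [Z], which add up to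
    1. *)
Lemma side_ratio_sum (X Y Z P : plane R) : side X Y Z != 0 ->
  side Y Z P / side X Y Z = 1 - (side Z X P / side X Y Z + side X Y P / side X Y Z).
Proof.
set D := side X Y Z => D0.
have -> : side Y Z P = D - (side Z X P + side X Y P) by rewrite /D /side; ring.
by field.
Qed.

(* The factor [side X Y Z] makes the three conditions independent of the orientation. *)
Definition triangle (X Y Z : plane R) : set (plane R) :=
  [set P | [/\ 0 <= side X Y Z * side X Y P, 0 <= side X Y Z * side Y Z P &
               0 <= side X Y Z * side Z X P]].

Lemma measurable_side_ge0 (k : R) (X Y : plane R) :
  measurable2 [set Z : plane R | 0 <= k * side X Y Z].
Proof.
have := measurable_halfplane (- k * (Y.2 - X.2)) (k * (Y.1 - X.1))
  (k * ((Y.2 - X.2) * X.1 - (Y.1 - X.1) * X.2)).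
congr measurable; apply/seteqP; split => -[x y]; rewrite /side/= => h;
  apply: (le_trans h); rewrite le_eqVlt; apply/orP; left; apply/eqP; ring.
Qed.

Lemma measurable_side_eq0 (X Y : plane R) :
  measurable2 [set Z : plane R | side X Y Z = 0].
Proof.
have := measurable_line (- (Y.2 - X.2)) (Y.1 - X.1)
  ((Y.2 - X.2) * X.1 - (Y.1 - X.1) * X.2).
congr measurable; apply/seteqP; split => -[x y]; rewrite /side/= => <-; ring.
Qed.

Lemma area_side_eq0 (X Y : plane R) : X != Y ->
  area [set Z : plane R | side X Y Z = 0] = 0%E.
Proof.
move=> XY; have := @area_line (- (Y.2 - X.2)) (Y.1 - X.1)
  ((Y.2 - X.2) * X.1 - (Y.1 - X.1) * X.2).
rewrite oppr_eq0 !subr_eq0 => <-.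
  by congr (area _); apply/seteqP; split => -[x y]; rewrite /side/= => <-; ring.
apply: contraNT XY; rewrite negb_or !negbK => /andP[/eqP e2 /eqP e1].
by apply/eqP; move: X Y e1 e2 => [? ?] [? ?] /= -> ->.
Qed.

Lemma measurable_triangle (X Y Z : plane R) : measurable2 (triangle X Y Z).
Proof.
rewrite (_ : triangle X Y Z = [set P : plane R | 0 <= side X Y Z * side X Y P] `&`
  [set P : plane R | 0 <= side X Y Z * side Y Z P] `&`
  [set P : plane R | 0 <= side X Y Z * side Z X P]).
  by apply: measurableI; [apply: measurableI|]; exact: measurable_side_ge0.
by apply/seteqP; split => P /= []; [move=> ? ? ?; split|move=> []].
Qed.

Lemma area_triangle (X Y Z : plane R) : side X Y Z != 0 ->
  area (triangle X Y Z) = (`|side X Y Z| / 2)%:E.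
Proof.
set D := side X Y Z => D0.
(* These are the coefficients of the affine map taking a point to its barycentric coordinates at [Y]
   and [Z]; it carries the triangle onto [unit_triangle]. *)
pose a := - (X.2 - Z.2) / D; pose b := (X.1 - Z.1) / D.
pose c := - (Y.2 - X.2) / D; pose d := (Y.1 - X.1) / D.
pose e := ((X.2 - Z.2) * Z.1 - (X.1 - Z.1) * Z.2) / D.
pose f := ((Y.2 - X.2) * X.1 - (Y.1 - X.1) * X.2) / D.
have detE : a * d - b * c = D^-1.
  rewrite /a /b /c /d; apply: (mulIf (mulf_neq0 D0 D0)); rewrite [RHS]mulKf//.
  by rewrite -[RHS]/(side X Y Z) /side; field.
have det0 : a * d - b * c != 0 by rewrite detE invr_eq0.
have := area_affine_map e f det0 measurable_unit_triangle.
rewrite detE area_unit_triangle.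
set T := _ @^-1` unit_triangle => areaE.
have <- : T = triangle X Y Z.
  have sumE P := side_ratio_sum P D0.
  have uE x y : a * x + b * y + e = side Z X (x, y) / D.
    by rewrite /a /b /e /side /=; field.
  have vE x y : c * x + d * y + f = side X Y (x, y) / D.
    by rewrite /c /d /f /side /=; field.
  by apply/seteqP; split => -[x y]; rewrite /T /triangle /= /unit_triangle/= -/D
    !(mulr_ge0_div _ D0) uE vE sumE subr_ge0 => -[].
have := congr1 (mule `|D|%:E) areaE.
by rewrite muleA -!EFinM -normrM mulfV// normr1 mul1e.
Qed.
(** * Area of a convex polygon *)

Lemma side_cycle (X Y Z : plane R) : side X Y Z = side Y Z X.
Proof. by rewrite /side; ring. Qed.

Lemma side_swap (X Y Z : plane R) : side Y X Z = - side X Y Z.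
Proof. by rewrite /side; ring. Qed.

Lemma side_xyx (X Y : plane R) : side X Y X = 0.
Proof. by rewrite /side; ring. Qed.

Lemma side_xyy (X Y : plane R) : side X Y Y = 0.
Proof. by rewrite /side; ring. Qed.

Lemma convex_set_conv (M : lmodType R) (C : set M) (X Y : M) (t : R) :
  convex_set C -> C X -> C Y -> 0 <= t <= 1 -> C (t *: X + (1 - t) *: Y).
Proof.
move=> cC CX CY /andP[t0 t1].
by have := cC X Y (Itv01 t0 t1); rewrite !inE => /(_ CX CY).
Qed.

Lemma convex_set_side (k : R) (X Y : plane R) :
  convex_set [set Z : plane R | 0 <= k * side X Y Z].
Proof.
move=> P Q t; rewrite !inE /= => hP hQ.
have t0 : 0 <= t%:num by [].
have t1 : 0 <= 1 - t%:num by rewrite subr_ge0.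
have := addr_ge0 (mulr_ge0 t0 hP) (mulr_ge0 t1 hQ).
congr (0 <= _); rewrite /side /= /conv/= /unstable.onem /GRing.scale/=; ring.
Qed.

Lemma triangle_sub_convex (C : set (plane R)) (X Y Z : plane R) :
  side X Y Z != 0 -> convex_set C -> C X -> C Y -> C Z -> triangle X Y Z `<=` C.
Proof.
set D := side X Y Z => D0 cC CX CY CZ P [].
rewrite -/D !(mulr_ge0_div _ D0).
set w := _ / D; set u := _ / D; set v := _ / D => w0 u0 v0.
have sumE : u = 1 - (v + w) := side_ratio_sum P D0.
have -> : P = u *: X + v *: Y + w *: Z.
  move: D0; rewrite sumE /v /w /D.
  case: P X Y Z {CX CY CZ D w u v w0 u0 v0 sumE} => [p1 p2] [x1 x2] [y1 y2] [z1 z2].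
  by rewrite /side/= => D0; congr pair; rewrite /= /GRing.scale/=; field.
clearbody u v w.
(* The combination of three points is built from two binary ones, the inner one with weights divided
   by [1 - w]; the vertex [Z] is therefore treated apart. *)
have [w1|w1] := eqVneq w 1.
  have -> : u = 0 by lra.
  have -> : v = 0 by lra.
  by rewrite w1 !scale0r !add0r scale1r.
have w1' : 1 - w != 0 by rewrite subr_eq0 eq_sym.
have -> : u *: X + v *: Y + w *: Z =
    (1 - w) *: ((u / (1 - w)) *: X + (1 - u / (1 - w)) *: Y) + (1 - (1 - w)) *: Z.
  rewrite scalerDr !scalerA; congr (_ *: _ + _ *: _ + _ *: _).
  - by field.
  - by rewrite sumE; field.
  - by ring.
apply: convex_set_conv => //; last by apply/andP; split; lra.
apply: convex_set_conv => //.
have w1p : 0 < 1 - w by rewrite lt_neqAle eq_sym w1'/=; lra.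
by rewrite divr_ge0 ?ler_pdivrMr ?mul1r ?(ltW w1p)//=; lra.
Qed.

(** * Fan triangulation of a convex polygon *)

Section fan.
Variables (n : nat) (Q : nat -> plane R) (s : R).
Hypothesis n0 : (0 < n)%N.
Hypothesis edge : forall j k, (j <= n)%N -> (k <= n.+1)%N -> k != j -> k != j.+1 ->
  0 < s * side (Q j) (Q j.+1) (Q k).
Hypothesis last_edge : forall k, (1 <= k <= n)%N ->
  0 < s * side (Q n.+1) (Q 0%N) (Q k).

Let hull := convex_hull (Q @` [set j | (j <= n.+1)%N]).
(** The polygon as an intersection of half-planes, one per edge; [hullE] identifies it with the
    convex hull. The sign of [s] accounts for the orientation. *)
Let K : set (plane R) := [set z | 0 <= s * side (Q n.+1) (Q 0%N) z] `&`
  \bigcap_(j in `I_n.+1) [set z | 0 <= s * side (Q j) (Q j.+1) z].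
(* The part of K swept by a ray turning about [Q 0] until it passes through [Q k]. *)
Let F k : set (plane R) := K `&` [set z | 0 <= - s * side (Q 0%N) (Q k) z].
Let T k := triangle (Q 0%N) (Q k) (Q k.+1).

Let fan_gt0 k : (1 <= k <= n)%N -> 0 < s * side (Q 0%N) (Q k) (Q k.+1).
Proof. by move=> /andP[k1 kn]; rewrite side_cycle; apply: edge => //; lia. Qed.

Let fan_neq0 k : (1 <= k <= n)%N -> side (Q 0%N) (Q k) (Q k.+1) != 0.
Proof. by move=> /fan_gt0; apply: contraTneq => ->; rewrite mulr0 ltxx. Qed.

Let hull_subK : hull `<=` K.
Proof.
apply: smallest_sub.
  move=> X Y t; rewrite !inE => -[X1 X2] [Y1 Y2]; split.
    by have := @convex_set_side s (Q n.+1) (Q 0%N) X Y t; rewrite !inE; exact.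
  move=> j jn; have := @convex_set_side s (Q j) (Q j.+1) X Y t.
  by rewrite !inE; apply; [exact: X2|exact: Y2].
move=> _ [k /= kn <-]; split => /=.
  have [->|k0] := eqVneq k 0%N; first by rewrite side_xyy mulr0.
  have [->|k1] := eqVneq k n.+1; first by rewrite side_xyx mulr0.
  by apply/ltW/last_edge; lia.
move=> j /= jn; have [->|k0] := eqVneq k j; first by rewrite side_xyx mulr0.
have [->|k1] := eqVneq k j.+1; first by rewrite side_xyy mulr0.
by apply/ltW/edge; lia.
Qed.

Let T_sub_hull k : (1 <= k <= n)%N -> T k `<=` hull.
Proof.
move=> kn z Tz C [cC QC]; apply: (triangle_sub_convex (fan_neq0 kn)) Tz => //;
  by apply: QC; eexists; [|reflexivity] => /=; lia.
Qed.

Let triangleP k z : (1 <= k <= n)%N ->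
  T k z <-> [/\ 0 <= s * side (Q 0%N) (Q k) z, 0 <= s * side (Q k) (Q k.+1) z &
                0 <= - s * side (Q 0%N) (Q k.+1) z].
Proof.
move=> kn; have D0 := fan_gt0 kn.
have sE x : (0 <= side (Q 0%N) (Q k) (Q k.+1) * x) = (0 <= s * x).
  have s0 : s != 0 by apply: contraTneq D0 => ->; rewrite mul0r ltxx.
  have s2 : 0 < s ^+ 2 by rewrite exprn_even_gt0.
  rewrite -(pmulr_rge0 _ s2) -(pmulr_rge0 (s * x) D0).
  by congr (0 <= _); ring.
by rewrite /T /triangle /= !sE (side_swap _ (Q k.+1)) mulNr mulrN.
Qed.

Let F_mono k : (1 <= k <= n)%N -> F k `<=` F k.+1.
Proof.
move=> kn z [Kz Fz]; split=> //=; have [Kz1 _] := Kz; move: Fz Kz1 => /= Fz Kz1.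
have c1 := fan_gt0 kn; have c2 := last_edge kn.
have c3 : 0 <= s * side (Q 0%N) (Q k.+1) (Q n.+1).
  have [->|kn'] := eqVneq k n; first by rewrite side_xyy mulr0.
  by rewrite -side_cycle; apply/ltW/last_edge; lia.
(* Pluecker relation between the vectors from [Q 0] to z, [Q k], [Q k.+1], [Q n.+1]. *)
rewrite -(pmulr_rge0 _ c2).
have := addr_ge0 (mulr_ge0 Fz c3) (mulr_ge0 Kz1 (ltW c1)).
by congr (0 <= _); rewrite /side; ring.
Qed.

(** A point of [F k.+1] outside [F k] lies between the rays to [Q k] and [Q k.+1]; the half-plane of
    the edge between these two vertices then puts it in [T k]. *)
Let F_step k : (1 <= k <= n)%N -> F k.+1 = F k `|` T k.
Proof.
move=> kn; apply/seteqP; split => [z [Kz Fz]|z [/(F_mono kn)//|Tz]]; last first.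
  split; first by apply: hull_subK; exact: (T_sub_hull kn).
  by have /(triangleP z kn)[] := Tz.
have [h|h] := leP 0 (- s * side (Q 0%N) (Q k) z); first by left.
right; apply/(triangleP z kn); split=> //; first by move: h; rewrite mulNr; lra.
by case: Kz => _; apply => /=; lia.
Qed.

(** [K] lies on the inner side of the first edge while [F 1] asks for the outer side, so the sweep
    starts from a null set. *)
Let F1_sub_line : F 1%N `<=` [set z | side (Q 0%N) (Q 1%N) z = 0].
Proof.
move=> z [[_ /(_ 0%N erefl) /= h1] /=]; rewrite mulNr => h2.
have s0 : s != 0.
  by apply: contraTneq (fan_gt0 (k := 1) _) => [->|//]; rewrite mul0r ltxx.
by apply: (mulfI s0); rewrite mulr0; lra.
Qed.

(** The sweep ends at the closing edge, whose half-plane already contains [K]. *)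
Let F_last : F n.+1 = K.
Proof.
apply/seteqP; split => [z []//|z Kz]; split => //=.
by case: Kz => /=; rewrite side_swap; rewrite mulNr mulrN.
Qed.

Let F_sub_hull k : (1 <= k <= n)%N -> F k.+1 `<=` hull.
Proof.
elim: k => // k IH kn; rewrite F_step// => z []; last exact: T_sub_hull.
(* The degenerate starting piece [F 1] need not be empty, but it is contained in the first
   triangle. *)
have [k0|k0] := posnP k; last by apply: IH; lia.
rewrite k0 => F1; apply: (T_sub_hull (k := 1)) => //; apply/triangleP => //.
have [[_ Kz] _] := F1; split; [exact: (Kz 0%N)| exact: (Kz 1%N) |].
by case: (@F_mono 1%N _ _ F1).
Qed.

Let hullE : hull = K.
Proof.
apply/seteqP; split; first exact: hull_subK.
by rewrite -F_last; apply: F_sub_hull; rewrite n0 leqnn.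
Qed.

Let measurable_F k : measurable2 (F k).
Proof.
apply: measurableI; last exact: measurable_side_ge0.
apply: measurableI; first exact: measurable_side_ge0.
by apply: fin_bigcap_measurable => // j _; exact: measurable_side_ge0.
Qed.

Let vertex_neq k : (1 <= k <= n)%N -> Q 0%N != Q k.
Proof.
move=> kn; apply: contra_neq (fan_neq0 kn) => ->.
by rewrite -side_cycle side_xyy.
Qed.

Let area_F k : (k <= n)%N ->
  area (F k.+1) = (\sum_(1 <= j < k.+1) `|side (Q 0%N) (Q j) (Q j.+1)| / 2)%:E.
Proof.
elim: k => [_|k IH kn].
  rewrite big_geq//; apply: (@subset_measure0 _ _ _ area _ _ _ _ F1_sub_line).
  - exact: measurable_F.
  - exact: measurable_side_eq0.
  - by apply: area_side_eq0; exact: vertex_neq.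
have kn1 : (1 <= k.+1 <= n)%N by [].
have areaT := area_triangle (fan_neq0 kn1).
have mT : measurable2 (T k.+1) by exact: measurable_triangle.
have fT : (area (T k.+1) < +oo)%E by rewrite areaT ltry.
(* The part already swept and the next triangle meet only on the line through [Q 0] and [Q k.+1]. *)
have null : area (F k.+1 `&` T k.+1) = 0%E.
  apply: (@subset_measure0 _ _ _ area _ [set z | side (Q 0%N) (Q k.+1) z = 0]).
  - by apply: measurableI => //; exact: measurable_F.
  - exact: measurable_side_eq0.
  - move=> z [[_ /= h1]] /(triangleP _ kn1)[h2 _ _].
    have s0 : s != 0.
      by apply: contraTneq (fan_gt0 kn1) => ->; rewrite mul0r ltxx.
    by apply: (mulfI s0); rewrite mulr0; move: h1; rewrite mulNr; lra.
  - by apply: area_side_eq0; exact: vertex_neq.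
rewrite F_step// (measureUfinr (measurable_F _) mT fT)/= null sube0 IH; last lia.
by rewrite areaT -EFinD [in RHS]big_nat_recr.
Qed.

Lemma area_fan :
  area hull = (\sum_(1 <= j < n.+1) `|side (Q 0%N) (Q j) (Q j.+1)| / 2)%:E.
Proof. by rewrite hullE -F_last area_F. Qed.

End fan.

End planar_area.

(** * Tangent lengths *)

Section tangent_lengths.
Context {R : realType}.

Lemma dist_ge0 (X Y : plane R) : 0 <= dist X Y.
Proof. exact: sqrtr_ge0. Qed.

Lemma dist_sqr (X Y : plane R) :
  dist X Y ^+ 2 = (X.1 - Y.1) ^+ 2 + (X.2 - Y.2) ^+ 2.
Proof. by rewrite sqr_sqrtr// addr_ge0 ?sqr_ge0. Qed.

Lemma distC (X Y : plane R) : dist X Y = dist Y X.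
Proof. by rewrite /dist; congr Num.sqrt; ring. Qed.

Lemma dist_segment (X Y F : plane R) : segment X Y F ->
  dist X Y = dist X F + dist Y F.
Proof.
have scale_dist (t : R) (P P' : plane R) : 0 <= t ->
    P.1 - P'.1 = t * (X.1 - Y.1) -> P.2 - P'.2 = t * (X.2 - Y.2) ->
    dist P P' = t * dist X Y.
  move=> t0 e1 e2; rewrite -(ger0_norm t0) -sqrtr_sqr -sqrtrM ?sqr_ge0//.
  by congr Num.sqrt; rewrite e1 e2; ring.
case=> u; rewrite /= in_itv/= => /andP[u0 u1] <-.
have sub1 (t a b : R) : a - (a + t * (b - a)) = t * (a - b) by ring.
have sub2 (t a b : R) : a + t * (b - a) - b = (1 - t) * (a - b) by ring.
rewrite (scale_dist u X (X + u *: (Y - X)))//;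
  [|exact: (sub1 u X.1 Y.1)|exact: (sub1 u X.2 Y.2)].
rewrite (distC Y) (scale_dist (1 - u) (X + u *: (Y - X)) Y) ?subr_ge0//;
  [|exact: (sub2 u X.1 Y.1)|exact: (sub2 u X.2 Y.2)].
by rewrite -mulrDl addrC subrK mul1r.
Qed.

Lemma tangent_lengths_dist (X Y Z : plane R) (x y z : R) :
  tangent_lengths X Y Z x y z ->
  [/\ dist X Y = x + y, dist Y Z = y + z & dist X Z = x + z].
Proof.
case=> O [rho [D [E [F [[_ [YZD _] [ZXE _] [XYF _]] [XE XF] [YD YF] [ZD ZE']]]]]].
rewrite (dist_segment YZD) (dist_segment XYF) (distC X Z) (dist_segment ZXE).
by rewrite YD ZD XF YF ZE' XE; split=> //; exact: addrC.
Qed.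

Lemma tangent_lengths_ge0 (X Y Z : plane R) (x y z : R) :
  tangent_lengths X Y Z x y z -> [/\ 0 <= x, 0 <= y & 0 <= z].
Proof.
by case=> O [rho [D [E [F [_ [<- _] [<- _] [<- _]]]]]]; split; exact: dist_ge0.
Qed.

(** Heron's formula for twice the signed area: Lagrange's identity and the law of cosines express
    the square of [side] through the three edge lengths. *)
Lemma heron (X Y Z : plane R) (x y z : R) : tangent_lengths X Y Z x y z ->
  side X Y Z ^+ 2 = 4 * ((y + x + z) * y * x * z).
Proof.
case/tangent_lengths_dist => dXY dYZ dXZ.
have := dist_sqr X Y; have := dist_sqr Y Z; have := dist_sqr X Z.
rewrite dXY dYZ dXZ => eXZ eYZ eXY.
have -> : side X Y Z ^+ 2 = dist X Y ^+ 2 * dist X Z ^+ 2 -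
    ((dist X Y ^+ 2 + dist X Z ^+ 2 - dist Y Z ^+ 2) / 2) ^+ 2.
  by rewrite !dist_sqr /side; field.
by rewrite dXY dYZ dXZ; field.
Qed.

(** By Heron's formula a vanishing tangent length would make the triangle degenerate. *)
Lemma tangent_lengths_gt0 (X Y Z : plane R) (x y z : R) : side X Y Z != 0 ->
  tangent_lengths X Y Z x y z -> [/\ 0 < x, 0 < y & 0 < z].
Proof.
move=> D0 H; have [x0 y0 z0] := tangent_lengths_ge0 H.
move: D0; rewrite -sqrf_eq0 (heron H) !mulf_eq0 !negb_or.
case/and3P => _ /andP[/andP[_ yn]] xn zn.
by rewrite !lt_neqAle x0 y0 z0 ![0 == _]eq_sym xn yn zn.
Qed.

Definition dot (O X Y : plane R) : R :=
  (X.1 - O.1) * (Y.1 - O.1) + (X.2 - O.2) * (Y.2 - O.2).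

Lemma dot_dist (O X Y : plane R) :
  dot O X Y = (dist O X ^+ 2 + dist O Y ^+ 2 - dist X Y ^+ 2) / 2.
Proof. by rewrite !dist_sqr /dot; field. Qed.

(* The cotangents of opposite angles of a cyclic quadrilateral VXYZ add up to zero. *)
Lemma concyclic_dot_side (O V X Y Z : plane R) (rho : R) :
  circle O rho V -> circle O rho X -> circle O rho Y -> circle O rho Z ->
  dot X V Y * side V Y Z + dot Z V Y * side V X Y = 0.
Proof.
rewrite /circle/= => OV OX OY OZ.
(* Once the four distances are equal, the coefficients cancel: cutting the quadrilateral along
   either diagonal gives the same total signed area. *)
have -> : dot X V Y * side V Y Z + dot Z V Y * side V X Y =
    dist O X ^+ 2 * side V Y Z - dist O V ^+ 2 * side X Y Z
    - dist O Y ^+ 2 * side V X Z + dist O Z ^+ 2 * side V X Y.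
  by rewrite !dist_sqr /dot /side; ring.
by rewrite OV OX OY OZ /side; ring.
Qed.

(* With u = sqrt (a / b) and u' = sqrt (a' / b'), hypothesis h reads
   u - 1/u = - (u' - 1/u'), whence u u' = 1. *)
Lemma half_angle_product (a b a' b' c c' : R) :
  0 < a -> 0 < b -> 0 < a' -> 0 < b' -> 0 < c * c' ->
  c ^+ 2 = 4 * (a * b) -> c' ^+ 2 = 4 * (a' * b') ->
  (a - b) * c' + (a' - b') * c = 0 -> a * a' = b * b'.
Proof.
move=> a0 b0 a'0 b'0 cc ce ce' h.
(* Squaring [h] loses a sign and leaves two cases, [u * u' = 1] and [u = u']. *)
have e : (a * a' - b * b') * (a * b' - a' * b) = 0.
  have : ((a - b) * c') ^+ 2 = ((a' - b') * c) ^+ 2.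
    by rewrite (_ : (a - b) * c' = - ((a' - b') * c)) ?sqrrN//; lra.
  rewrite !exprMn ce ce' => E; lra.
move/eqP: e; rewrite mulf_eq0 !subr_eq0 => /orP[/eqP//|/eqP e].
(* In the case [u = u'] the sign condition on [c * c'] makes the second factor positive, so [a = b],
   and then [a' = b']. *)
have /eqP : (a - b) * (a * (c * c') + a' * c ^+ 2) = 0.
  transitivity (c * (a * ((a - b) * c' + (a' - b') * c) + c * (a * b' - a' * b))).
    by ring.
  by rewrite h e subrr !mulr0 addr0 mulr0.
have pos : 0 < a * (c * c') + a' * c ^+ 2.
  by apply: ltr_wpDr; [rewrite mulr_ge0 ?sqr_ge0 ?ltW|rewrite mulr_gt0].
rewrite mulf_eq0 (gt_eqF pos) orbF subr_eq0 => /eqP ab.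
by move: e; rewrite ab mulrC => /(mulIf (lt0r_neq0 b0)) ->; exact: mulrC.
Qed.

End tangent_lengths.

(** * Summing the triangle areas, the relation between neighbouring triangles, and orientation *)

Section convex_cyclic_polygon.
Context {R : realType}.

Lemma sum_areas_sqr (n : nat) (s r t p D : nat -> R) :
  (1 <= n)%N ->
  (forall j, (1 <= j <= n)%N -> [/\ 0 < s j, 0 < r j, 0 < t j & 0 < p j]) ->
  (forall j, (1 <= j <= n)%N -> 0 <= D j /\ D j ^+ 2 = p j * r j * s j * t j) ->
  (forall j, (1 <= j < n)%N ->
     p j * r j * (p j.+1 * t j.+1) = s j * t j * (r j.+1 * s j.+1)) ->
  (\sum_(1 <= j < n.+1) D j) ^+ 2 =
  (p 1%N * r 1%N
      + \sum_(2 <= q < n.+1) r q * s q * \prod_(2 <= m < q) (s m / p m))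
   * (s 1%N * t 1%N
      + \sum_(2 <= q < n.+1) p q * t q * \prod_(2 <= m < q) (p m / s m)).
Proof.
move=> n1 pos DE rel.
have [s1 r1 t1 p1] := pos 1%N n1.
(* The common ratio of corresponding summands of the two factors, read off from their first
   terms. *)
pose kappa := p 1%N * r 1%N / (s 1%N * t 1%N).
have st1 : s 1%N * t 1%N != 0 by rewrite gt_eqF ?mulr_gt0.
have kappa_gt0 : 0 < kappa by rewrite divr_gt0 ?mulr_gt0.
have prE : p 1%N * r 1%N = kappa * (s 1%N * t 1%N) by rewrite mulfVK.
pose u q := \prod_(2 <= m < q) (s m / p m).
pose v q := \prod_(2 <= m < q) (p m / s m).
have uS q : (2 <= q)%N -> u q.+1 = u q * (s q / p q).
  by move=> ?; rewrite /u big_nat_recr.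
have vS q : (2 <= q)%N -> v q.+1 = v q * (p q / s q).
  by move=> ?; rewrite /v big_nat_recr.
have v_gt0 q : (q <= n.+1)%N -> 0 < v q.
  move=> qn; rewrite /v big_nat; apply: prodr_gt0 => m mq.
  by have [? _ _ ?] := pos m ltac:(lia); rewrite divr_gt0.
have uv q : (q <= n.+1)%N -> u q * v q = 1.
  move=> qn; rewrite /u /v -big_split big_nat big1// => m mq.
  have [sm _ _ pm] := pos m ltac:(lia).
  by rewrite /= mulf_div (mulrC (s m)) divff// mulf_neq0 ?gt_eqF.
(* Induction on [q] through [rel]. At [q = 2] both products are empty and [rel] for the first two
   triangles gives the claim. *)
have ab q : (2 <= q <= n)%N -> r q * s q * u q = kappa * (p q * t q * v q).
  elim: q => // q IH qn; have [q2|q2] := ltnP q 2.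
    have -> : q = 1%N by lia.
    rewrite /u /v !big_geq// !mulr1 /kappa.
    have -> : p 1%N * r 1%N / (s 1%N * t 1%N) * (p 2 * t 2) =
      p 1%N * r 1%N * (p 2 * t 2) / (s 1%N * t 1%N) by ring.
    have -> : p 1%N * r 1%N * (p 2 * t 2) = s 1%N * t 1%N * (r 2 * s 2).
      by apply: rel; lia.
    by rewrite mulrAC divff// mul1r.
  have [sq rq tq pq] := pos q ltac:(lia).
  have := rel q ltac:(lia); have := IH ltac:(lia).
  rewrite uS// vS//; set U := u q; set V := v q => e1 e2.
  have [sn pn tn] : [/\ s q != 0, p q != 0 & t q != 0] by rewrite !gt_eqF.
  have n0 : p q * s q * t q != 0 by rewrite !mulf_neq0.
  apply: (mulIf n0); transitivity (s q * U * (s q * t q * (r q.+1 * s q.+1))).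
    by field.
  rewrite -e2; transitivity (p q * (p q.+1 * t q.+1) * (r q * s q * U)).
    by ring.
  by rewrite e1; field; rewrite sn.
(* Since [u q * v q = 1], [D q] is the geometric mean of two summands whose ratio is [kappa]. *)
have DqE q : (2 <= q <= n)%N -> D q = Num.sqrt kappa * (p q * t q * v q).
  move=> qn; have [sq rq tq pq] := pos q ltac:(lia).
  have [D0 D2] := DE q ltac:(lia).
  have vq : 0 < v q by apply: v_gt0; lia.
  rewrite -[LHS](ger0_norm D0) -sqrtr_sqr D2.
  rewrite -[X in _ = _ * X]ger0_norm -?sqrtr_sqr -?sqrtrM ?(ltW kappa_gt0)
    ?mulr_ge0 ?ltW//.
  congr Num.sqrt; rewrite expr2 mulrA -ab//.
  have := uv q ltac:(lia) => e.
  transitivity (p q * r q * s q * t q * (u q * v q)); first by rewrite e mulr1.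
  ring.
have D1E : D 1%N = Num.sqrt kappa * (s 1%N * t 1%N).
  have [D0 D2] := DE 1%N n1.
  rewrite -[LHS](ger0_norm D0) -sqrtr_sqr D2.
  rewrite -[X in _ = _ * X]ger0_norm -?sqrtr_sqr -?sqrtrM ?(ltW kappa_gt0)
    ?mulr_ge0 ?ltW//.
  congr Num.sqrt; rewrite expr2 mulrA -prE; ring.
rewrite big_ltn// D1E prE.
rewrite (eq_big_nat _ _ (F2 := fun q => Num.sqrt kappa * (p q * t q * v q)));
  last by move=> q ?; apply: DqE; lia.
rewrite [X in _ = (_ + X) * _](eq_big_nat _ _
    (F2 := fun q => kappa * (p q * t q * v q)));
  last by move=> q ?; apply: ab; lia.
rewrite -!mulr_sumr -!mulrDr exprMn sqr_sqrtr ?ltW//.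
by rewrite expr2 mulrA.
Qed.

(** The squared tangents of the half angles at the opposite vertices [X] and [Z] are
    [s * t / (p * r)] and [r' * s' / (p' * t')], with [p] and [p'] the semiperimeters;
    [half_angle_product] says that their product is 1. *)
Lemma cyclic_fan_relation (V X Y Z : plane R) (s r t s' r' t' : R) :
  0 < side V X Y * side V Y Z ->
  (exists O rho,
    [/\ circle O rho V, circle O rho X, circle O rho Y & circle O rho Z]) ->
  tangent_lengths V X Y s r t -> tangent_lengths V Y Z s' r' t' ->
  (r + s + t) * r * ((r' + s' + t') * t') = s * t * (r' * s').
Proof.
move=> c0 [x [rho [xV xX xY xZ]]] T T'.
have [c1 c2] : side V X Y != 0 /\ side V Y Z != 0.
  by split; apply: contraTneq c0 => ->; rewrite ?mul0r ?mulr0 ltxx.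
have [s0 r0 t0] := tangent_lengths_gt0 c1 T.
have [s0' r0' t0'] := tangent_lengths_gt0 c2 T'.
have [dVX dXY dVY] := tangent_lengths_dist T.
have [dVY' dYZ dVZ] := tangent_lengths_dist T'.
apply: (@half_angle_product R _ _ _ _ (side V X Y) (side V Y Z)) => //.
- by rewrite mulr_gt0 ?addr_gt0.
- by rewrite mulr_gt0.
- by rewrite mulr_gt0 ?addr_gt0.
- by rewrite mulr_gt0.
- by rewrite (heron T); ring.
- by rewrite (heron T'); ring.
have := concyclic_dot_side xV xX xY xZ.
have -> : dot X V Y = (r + s + t) * r - s * t.
  by rewrite dot_dist (distC X V) dVX dXY dVY; field.
have -> // : dot Z V Y = (r' + s' + t') * t' - r' * s'.
by rewrite dot_dist (distC Z V) (distC Z Y) dVZ dYZ dVY'; field.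
Qed.

Lemma ordS_val (n : nat) (i : 'I_n.+2) :
  ordS i = (if i == n.+1 :> nat then 0 else i.+1) :> nat.
Proof.
rewrite /=; case: eqP => [->|/eqP ne]; first by rewrite modnn.
by rewrite modn_small// ltnS ltn_neqAle ne -ltnS ltn_ord.
Qed.

Lemma ordS_inord (n j : nat) : (j <= n)%N -> ordS (inord j : 'I_n.+2) = inord j.+1.
Proof.
move=> jn; apply: ord_inj; rewrite ordS_val !inordK; [|lia..].
by case: eqP => //; lia.
Qed.

(* Consecutive edges see their common triple of vertices with the same sign. *)
Lemma convex_polygon_sign (n : nat) (P : 'I_n.+2 -> plane R) : (1 <= n)%N ->
  convex_polygon P -> exists2 e : R, e != 0 &
  forall i k : 'I_n.+2, k != i -> k != ordS i ->
    0 < e * side (P i) (P (ordS i)) (P k).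
Proof.
move=> n1 cP.
pose pos e i := forall k : 'I_n.+2, k != i -> k != ordS i ->
  0 < e * side (P i) (P (ordS i)) (P k).
have posP i : pos 1 i \/ pos (-1) i.
  by case: (cP i) => h; [left|right] => k k1 k2; [rewrite mul1r; exact: h|
    rewrite mulN1r oppr_gt0; exact: h].
have step e e' i : pos e i -> pos e' (ordS i) -> 0 < e * e'.
  move=> h hn.
  have iE := ordS_val i; have iE' := ordS_val (ordS i); have i_lt := ltn_ord i.
  (* Since [1 <= n] there are at least three vertices, so three cyclically consecutive ones are
     distinct. *)
  have ne1 : ordS (ordS i) != i.
    apply/eqP => /(congr1 (@nat_of_ord _)); rewrite iE' iE.
    by case: (i =P n.+1 :> nat) => ?; case: eqP; lia.
  have ne2 : ordS (ordS i) != ordS i.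
    apply/eqP => /(congr1 (@nat_of_ord _)); rewrite iE' iE.
    by case: (i =P n.+1 :> nat) => ?; case: eqP; lia.
  have ne3 : i != ordS i.
    by apply/eqP => /(congr1 (@nat_of_ord _)); rewrite iE; case: eqP; lia.
  have {h} h := h (ordS (ordS i)) ne1 ne2.
  have {hn} := hn i ne3; rewrite eq_sym => /(_ ne1).
  rewrite -side_cycle => hn.
  have := mulr_gt0 h hn; rewrite mulrACA pmulr_lgt0//.
  rewrite -expr2 exprn_even_gt0//=.
  by apply: contraTneq h => ->; rewrite mulr0 ltxx.
have all e : e = 1 \/ e = -1 -> pos e ord0 -> forall i, pos e i.
  move=> e1 e0 i; rewrite -(inord_val i); move: (leq_ord i).
  elim: (val i) => [_|j IH jn].
    by rewrite (_ : inord 0 = ord0)//; apply: val_inj; rewrite /= inordK.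
  have {}IH := IH (ltnW jn).
  have [h|h] := posP (inord j.+1); move: (h);
    rewrite -{1}ordS_inord//; move=> /(step _ _ _ IH).
    by case: e1 => ->; rewrite ?mulr1 ?mulN1r ?oppr_gt0 ?ltr10.
  by case: e1 => -> //; rewrite ?mul1r oppr_gt0 ltr10.
by case: (posP ord0) => h; [exists 1|exists (-1)]; rewrite ?oppr_eq0 ?oner_eq0//;
  apply: all h; [left|right].
Qed.

End convex_cyclic_polygon.

Theorem theorem10 (R : realType) (n : nat) (hn : (1 <= n)%N)
    (P : 'I_n.+2 -> plane R)
    (Pconvex : convex_polygon P) (Pcyclic : cyclic_polygon P)
    (s r t p : nat -> R)
    (Htan : forall j : nat, (1 <= j <= n)%N ->
       tangent_lengths (P ord0) (P (inord j)) (P (inord j.+1)) (s j) (r j) (t j))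
    (Hp : forall j : nat, (1 <= j <= n)%N -> p j = r j + s j + t j) :
  (convex_polygon_area P ^+ 2)%E =
  ((p 1%N * r 1%N
      + \sum_(2 <= q < n.+1) r q * s q * \prod_(2 <= m < q) (s m / p m))
   * (s 1%N * t 1%N
      + \sum_(2 <= q < n.+1) p q * t q * \prod_(2 <= m < q) (p m / s m)))%:E.
Proof.
have [e e0 side_gt0] := convex_polygon_sign hn Pconvex.
pose Q j := P (inord j).
have Q0 : P ord0 = Q 0%N by congr P; apply: val_inj; rewrite /= inordK.
have inord_neq j k : (j <= n.+1)%N -> (k <= n.+1)%N -> k != j ->
    inord k != inord j :> 'I_n.+2.
  by move=> jn kn; apply: contra_neq => /(congr1 val) /=; rewrite !inordK.
have edge j k : (j <= n)%N -> (k <= n.+1)%N -> k != j -> k != j.+1 ->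
    0 < e * side (Q j) (Q j.+1) (Q k).
  move=> jn kn kj kj1; rewrite /Q -(ordS_inord jn); apply: side_gt0.
    by apply: inord_neq => //; lia.
  by rewrite ordS_inord//; exact: inord_neq.
(* The closing edge is separate because [ordS] wraps around there, unlike the successor on natural
   numbers. *)
have last_edge k : (1 <= k <= n)%N -> 0 < e * side (Q n.+1) (Q 0%N) (Q k).
  move=> kn; have ordS_last : ordS (inord n.+1) = inord 0 :> 'I_n.+2.
    by apply: ord_inj; rewrite ordS_val !inordK// eqxx.
  rewrite /Q -ordS_last; apply: side_gt0; first by apply: inord_neq; lia.
  by rewrite ordS_last; apply: inord_neq; lia.
pose D j := side (Q 0%N) (Q j) (Q j.+1).
have D_gt0 j : (1 <= j <= n)%N -> 0 < e * D j.
  by move=> jn; rewrite /D side_cycle; apply: edge; lia.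
have D_neq0 j : (1 <= j <= n)%N -> D j != 0.
  by move=> /D_gt0; apply: contraTneq => ->; rewrite mulr0 ltxx.
have pos j : (1 <= j <= n)%N -> [/\ 0 < s j, 0 < r j & 0 < t j].
  move=> jn; apply: (tangent_lengths_gt0 (D_neq0 j jn)).
  by rewrite -Q0; exact: Htan.
have -> : convex_polygon_area P = (\sum_(1 <= j < n.+1) `|D j| / 2)%:E.
  rewrite -(area_fan hn edge last_edge) /convex_polygon_area.
  congr (_ (convex_hull _)); apply/seteqP; split=> [_ [i _ <-]|_ [j _ <-]].
    by exists (val i); [exact: leq_ord|rewrite /Q inord_val].
  by exists (inord j).
rewrite -EFin_expe; congr EFin; apply: sum_areas_sqr => // j jn.
- have [s0 r0 t0] := pos j jn.
  by split=> //; rewrite Hp// !addr_gt0.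
- split; first by rewrite divr_ge0.
  (* The area of [T_j] is half of the absolute value of [D j]; squaring the half cancels the factor
     4 in [heron]. *)
  rewrite expr_div_n (real_normK (num_real _)).
  rewrite (heron (x := s j) (y := r j) (z := t j)); last first.
    by rewrite -Q0; exact: Htan.
  by rewrite Hp//; field.
have jn1 : (1 <= j <= n)%N by lia.
have jn2 : (1 <= j.+1 <= n)%N by lia.
rewrite !Hp//; apply: (@cyclic_fan_relation R (P ord0) (Q j) (Q j.+1) (Q j.+2)).
(* Neighbouring triangles have the same orientation, both having the sign of [e]. *)
- have : 0 < e ^+ 2 by rewrite exprn_even_gt0//= e0.
  move/pmulr_rgt0 => <-; rewrite expr2 mulrACA Q0.
  by rewrite mulr_gt0// D_gt0.
- by have [x [rho [_ xP]]] := Pcyclic; exists x, rho; split; exact: xP.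
- exact: Htan.
- exact: Htan.
Qed.
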